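(* Let $X$, $L=\{L_U\}_{U\in\tau}$, $R=\{R_U\}_{U\in\tau}$ and $B_1,\dots,B_m$ be as described in the context (in particular $X$ satisfies property (P), and $L$ and $R$ satisfy the locality and restriction properties), and let $h\in\operatorname{Dom}(R_{\mathbb{R}})=\operatorname{im}(L_{\mathbb{R}})$. Assume that $L$ commutes with $R$ and that there exists $G\in Z$ such that (I) $(RL)_\vdash G=0$; (II) $B_{i\,\vdash}G=0$, $i=1,\dots,m$; (III) $(B_iR)_\vdash G=0$, $i=1,\dots,m$; (IV) $RLH_Gh=H_{(RL)_\vdash G}h+h$; (V) $LH_{R_\vdash G}h=H_{L_\vdash R_\vdash G}h+h$; (VI) $B_iH_G=H_{B_{i\,\vdash}G}$, $i=1,\dots,m$; (VII) $B_iRH_G=B_iH_{R_\vdash G}=H_{(B_iR)_\vdash G}$, $i=1,\dots,m$. Then $v:=H_G(h)$ is a solution of the problem $$RLv=h,\qquad B_iv=0,\quad B_iRv=0,\quad i=1,\dots,m,$$ and $u:=H_{R_\vdash G}(h)$ is a solution of the problem $$Lu=h,\qquad B_iu=0,\quad i=1,\dots,m.$$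
   Context: Let $\tau$ be the usual topology of $\mathbb{R}$, and let $\mathcal{L}(V,W)$ denote the space of linear maps $V\to W$. $X$ is a vector subspace of $L^1_{\mathrm{loc}}(\mathbb{R})$; for $U\in\tau$, $X_U:=\{f|_U: f\in X\}$. It is assumed that $X$ satisfies (P) For every partition $\{S_j\}_{j\in J}\cup\{N\}$ of $\mathbb{R}$ into measurable sets, where $N$ has no accumulation points and the $S_j$ are open, if $f_j\in X_{S_j}$ for every $j\in J$, then there exists $f\in X$ such that $f|_{S_j}=f_j$ for every $j\in J$. $L=\{L_U\}_{U\in\tau}$ and $R=\{R_U\}_{U\in\tau}$ are two families of linear operators satisfying: - Locality: $L_U\in\mathcal{L}(X_U,L^1_{\mathrm{loc}}(U))$ and $R_U\in\mathcal{L}(\operatorname{im}(L_U),L^1_{\mathrm{loc}}(U))$; - Restriction: $L_V(f|_V)=L_U(f)|_V$ and $R_V(f|_V)=R_U(f)|_V$ for all $U,V\in\tau$ with $V\subset U$. It is assumed that $X_U\subset\operatorname{im}(L_U)\subset\operatorname{im}(R_U)$ for every $U\in\tau$, and that $B_i\in\mathcal{L}(\operatorname{im}(R_{\mathbb{R}}),\mathbb{R})$, $i=1,\dots,m$. When applied to functions on $\mathbb{R}$, $L$ and $R$ stand for $L_{\mathbb{R}}$ and $R_{\mathbb{R}}$. ''$L$ commutes with $R$'' means $LR=RL$ (wherever the compositions are defined). $Z$ is the vector space of functions $G:\mathbb{R}^2\to\mathbb{R}$ such that, for every $t\in\mathbb{R}$, $G(t,\cdot)\in X\cap L^2(\mathbb{R})$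 and $\operatorname{supp}G(t,\cdot)$ is compact. For an operator (or functional) $\mathcal{T}$ on functions of one variable, $\mathcal{T}_\vdash$ denotes its action on the first variable: $\mathcal{T}_\vdash G(t,s):=\mathcal{T}(G(\cdot,s))|_t$ for every $s$ (for a functional such as $B_i$ or $B_iR$, the result $\mathcal{T}(G(\cdot,s))$ depends on $s$ only). For a kernel $K$, $H_K$ is the operator $H_K(h)|_t:=\int_{\mathbb{R}}K(t,s)h(s)\,\mathrm{d}s$; if $K$ depends on $s$ only, $H_K(h)=\int_{\mathbb{R}}K(s)h(s)\,\mathrm{d}s$. Hypotheses (I)–(VII) are understood to include that the expressions appearing in them are well defined (the functions lie in the domains of the operators applied to them and the integrals exist); the operator identities (VI) and (VII) are understood as holding when applied to $h$. *)

(* Defs.v *)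
From HB Require Import structures.
From mathcomp Require Import all_boot all_order all_algebra.
From mathcomp Require Import generic_quotient.
From mathcomp Require Import all_classical all_reals all_analysis.

Set Implicit Arguments.
Unset Strict Implicit.
Unset Printing Implicit Defensive.
Import Order.TTheory GRing.Theory Num.Theory.
Import numFieldNormedType.Exports.
Local Open Scope classical_set_scope.
Local Open Scope ring_scope.

(* A function on an open set U is represented by a total function R -> R of
   which only the values on U matter; aefun U is the quotient of R -> R by
   almost-everywhere equality on U, so that equality in aefun U is equality of
   classes of functions on U. *)
Section AeFun.
Context {R : realType}.
Local Notation mu := (@lebesgue_measure R).

#[local] Instance ae_lebesgue_filter : Filter (almost_everywhere mu) :=
  ae_filter_ringOfSetsType mu.

Section Quotient.
Variable U : set R.

Definition ae_eqb (f g : R -> R) : bool := `[< f = g %[ae mu in U] >].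

Let ae_eqb_refl : reflexive ae_eqb.
Proof. by move=> f; apply/asboolP; apply: aeW. Qed.

Let ae_eqb_sym : symmetric ae_eqb.
Proof.
by move=> f g; apply/idP/idP => /asboolP h; apply/asboolP; exact: ae_eq_sym.
Qed.

Let ae_eqb_trans : transitive ae_eqb.
Proof.
move=> g f h /asboolP fg /asboolP gh; apply/asboolP.
exact: ae_eq_trans fg gh.
Qed.

Canonical ae_equiv := EquivRel ae_eqb ae_eqb_refl ae_eqb_sym ae_eqb_trans.

Local Open Scope quotient_scope.

Definition aefun : Type := {eq_quot ae_eqb}.
HB.instance Definition _ := Choice.on aefun.
HB.instance Definition _ := EqQuotient.on aefun.

Definition cls (f : R -> R) : aefun := \pi_aefun f.

Lemma cls_eqP f g : cls f = cls g <-> f = g %[ae mu in U].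
Proof. by split=> [/eqquotP /asboolP//|fg]; apply/eqquotP/asboolP. Qed.

Lemma cls_repr q : cls (repr q) = q. Proof. exact: reprK. Qed.

Definition aefun_add (p q : aefun) : aefun := cls (repr p + repr q).
Definition aefun_opp (p : aefun) : aefun := cls (- repr p).
Definition aefun_scale (a : R) (p : aefun) : aefun := cls (a *: repr p).

Let repr_cls f : repr (cls f) = f %[ae mu in U].
Proof. by apply/cls_eqP; rewrite cls_repr. Qed.

Let addE f g : aefun_add (cls f) (cls g) = cls (f + g).
Proof.
apply/cls_eqP; apply: filterS2 (repr_cls f) (repr_cls g) => x + + Ux.
by rewrite !fctE => -> // ->.
Qed.

Let oppE f : aefun_opp (cls f) = cls (- f).
Proof.
by apply/cls_eqP; apply: filterS (repr_cls f) => x + Ux; rewrite !fctE => ->.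
Qed.

Let scaleE a f : aefun_scale a (cls f) = cls (a *: f).
Proof.
by apply/cls_eqP; apply: filterS (repr_cls f) => x + Ux; rewrite !fctE => ->.
Qed.

Let addA : associative aefun_add.
Proof.
move=> p q r; rewrite -(cls_repr p) -(cls_repr q) -(cls_repr r).
by rewrite !addE addrA.
Qed.

Let addC : commutative aefun_add.
Proof. by move=> p q; rewrite /aefun_add addrC. Qed.

Let add0 : left_id (cls 0) aefun_add.
Proof. by move=> p; rewrite -(cls_repr p) addE add0r. Qed.

Let addN : left_inverse (cls 0) aefun_opp aefun_add.
Proof. by move=> p; rewrite -(cls_repr p) oppE addE addNr. Qed.

HB.instance Definition _ := GRing.isZmodule.Build aefun addA addC add0 addN.

Let scaleA a b p : aefun_scale a (aefun_scale b p) = aefun_scale (a * b) p.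
Proof. by rewrite -(cls_repr p) !scaleE scalerA. Qed.

Let scale1 : left_id 1 aefun_scale.
Proof. by move=> p; rewrite -(cls_repr p) scaleE scale1r. Qed.

Let scaleDr : right_distributive aefun_scale +%R.
Proof.
move=> a p q; rewrite -(cls_repr p) -(cls_repr q).
by rewrite [_ + _]addE !scaleE [RHS]addE scalerDr.
Qed.

Let scaleDl p : {morph aefun_scale^~ p : a b / a + b}.
Proof. by move=> a b; rewrite -(cls_repr p) !scaleE [RHS]addE scalerDl. Qed.

HB.instance Definition _ :=
  GRing.Zmodule_isLmodule.Build R aefun scaleA scale1 scaleDr scaleDl.

Lemma cls0 : cls 0 = 0. Proof. by []. Qed.

Lemma clsD f g : cls (f + g) = cls f + cls g.
Proof. by rewrite [RHS]addE. Qed.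

Lemma clsZ a f : cls (a *: f) = a *: cls f.
Proof. by rewrite [RHS]scaleE. Qed.

(* locally_integrable asks for Borel measurability; as only one representative
   has to satisfy it, this is the usual space of classes of Lebesgue-measurable
   locally integrable functions. *)
Definition L1loc : set aefun := [set cls f | f in locally_integrable U].

End Quotient.

(* Only meaningful (independent of the representative) when V `<=` U. *)
Definition restr (U V : set R) (q : aefun U) : aefun V := cls V (repr q).

Lemma restr_cls (U V : set R) f :
  V `<=` U -> @restr U V (cls U f) = cls V f.
Proof.
move=> VU; apply/cls_eqP.
have /cls_eqP := cls_repr (cls U f).
by apply: filterS => x + /VU Ux => ->.
Qed.

End AeFun.

Arguments L1loc {R} U _.
Arguments restr {R U} V q.

(* Operators defined on a subspace D of V are represented by total functions,
   all requirements being restricted to D. *)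
Definition linear_on {R : realType} {V W : lmodType R} (D : set V)
    (T : V -> W) : Prop :=
  forall a u v, D u -> D v -> T (a *: u + v) = a *: T u + T v.

Section Setting.
Context {R : realType}.
Local Notation mu := (@lebesgue_measure R).
Local Notation E := (@aefun R setT).

Definition restr_space (X : set E) (U : set R) : set (aefun U) :=
  [set restr U f | f in X].
Arguments restr_space X U _ : clear implicits.

Definition property_P (X : set E) : Prop :=
  forall (J : Type) (S : J -> set R) (N : set R),
    trivIset setT S ->
    (forall j, S j `&` N = set0) ->
    \bigcup_j S j `|` N = setT ->
    measurable N -> limit_point N = set0 ->
    (forall j, measurable (S j)) -> (forall j, open (S j)) ->
    forall f : forall j, aefun (S j),
      (forall j, restr_space X (S j) (f j)) ->
      exists2 g : E, X g & forall j, restr (S j) g = f j.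

Definition op_family := forall U : set R, aefun U -> aefun U.

(* D U is the domain of T U. *)
Definition locality (D : forall U : set R, set (aefun U)) (T : op_family) :=
  forall U, open U ->
    linear_on (D U) (T U) /\ (forall f, D U f -> L1loc U (T U f)).

Definition restriction (D : forall U : set R, set (aefun U)) (T : op_family) :=
  forall U V, open U -> open V -> V `<=` U ->
    forall f, D U f -> T V (restr V f) = restr V (T U f).

(* Square-integrability of the class of f. *)
Definition L2 (f : R -> R) : Prop :=
  exists2 g : R -> R, g \in Lfun mu 2%:E & f = g %[ae mu].

Definition spaceZ (X : set E) : set (R -> R -> R) :=
  [set G | forall t, [/\ X (cls setT (G t)), L2 (G t) &
                         compact (closure [set s | G t s != 0])]].

(* Pointwise values f|_t of a class f are read off a choice ev of
   representatives (cls setT (ev f) = f). *)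
Definition act1 (ev : E -> R -> R) (T : E -> E) (G : R -> R -> R) :
    R -> R -> R :=
  fun t s => ev (T (cls setT (G^~ s))) t.

Definition act1_functional (B : E -> R) (G : R -> R -> R) : R -> R :=
  fun s => B (cls setT (G^~ s)).

(* Lebesgue integrability: equality almost everywhere to a Borel integrable
   function. On such functions the library's integral, a supremum over simple
   functions below the positive and negative parts, is the Lebesgue integral. *)
Definition ae_integrable (f : R -> R) : Prop :=
  exists2 g : R -> R, mu.-integrable setT (EFin \o g) & f = g %[ae mu].

Definition H (K : R -> R -> R) (h : R -> R) : R -> R :=
  fun t => \int[mu]_s (K t s * h s).

Definition H_defined (K : R -> R -> R) (h : R -> R) : Prop :=
  \forall t \ae mu, ae_integrable (fun s => K t s * h s).

Definition H1 (k : R -> R) (h : R -> R) : R := \int[mu]_s (k s * h s).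

Definition H1_defined (k : R -> R) (h : R -> R) : Prop :=
  ae_integrable (fun s => k s * h s).

End Setting.

Arguments restr_space {R} X U _.

(* Main.v *)
Require Import Defs.
From mathcomp Require Import all_boot all_order all_algebra.
From mathcomp Require Import all_classical all_reals all_analysis.
Import Order.TTheory GRing.Theory Num.Theory.
Import numFieldNormedType.Exports.
Local Open Scope classical_set_scope.
Local Open Scope ring_scope.

(** By [hIV] and [hV], applying the operator of the equation to an integral
    against [h] gives [h] plus the integral operator whose kernel is obtained by
    letting the operator act under the integral sign.  Both problems are
    therefore solved as soon as that second kernel vanishes.

    For [v], that kernel is [(RL)_|- G], which is zero by [hI].  For [u], it is
    [L_|- R_|- G]; since [L] and [R] commute on the columns [G(., s)], it is
    again [(RL)_|- G].  For the boundary conditions, the densities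
    [B_i_|- G] and [(B_i R)_|- G] are zero by [hII] and [hIII], so their
    integrals against [h] vanish.

    The one delicate point is that pointwise values of a class are those of a
    chosen representative, and the representative of the zero class need only
    vanish almost everywhere.  As the same representative [ev 0] serves for
    every [s], the exceptional set of [t] does not depend on [s]; hence for
    almost every [t] the kernel vanishes in [s] identically, and the integral
    operator is null ([cls_H_act1_eq0]). *)

Section NullKernels.
Context {R : realType}.
Local Notation E := (@aefun R setT).
Implicit Types (ev : E -> R -> R) (T : E -> E) (G : R -> R -> R).

Lemma H1_eq0 (k h : R -> R) : (forall s, k s = 0) -> H1 k h = 0.
Proof.
move=> k0; rewrite /H1; under eq_Rintegral => s _ do rewrite k0 mul0r.
by rewrite /Rintegral integral0.
Qed.

(** A sequence of actions on the first variable is the action of the composite: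
    passing to a representative in between loses nothing, because only its
    class is used. *)
Lemma act1_comp ev S T G : (forall f, cls setT (ev f) = f) ->
  act1 ev S (act1 ev T G) = act1 ev (S \o T) G.
Proof.
move=> evK; apply/funext => t; apply/funext => s.
by rewrite /act1 /= evK.
Qed.

(** Every column of the kernel is the same function [ev 0], which vanishes
    outside a null set of [t] that is independent of [s]. *)
Lemma cls_H_act1_eq0 ev T G (h : R -> R) :
  (forall f, cls setT (ev f) = f) ->
  (forall s, T (cls setT (G^~ s)) = 0) ->
  cls setT (H (act1 ev T G) h) = 0.
Proof.
move=> evK TG0; rewrite -cls0; apply/cls_eqP.
have /cls_eqP : cls setT (ev 0) = cls setT 0 by rewrite evK cls0.
have ae_filter := ae_filter_ringOfSetsType (@lebesgue_measure R).
apply: filterS => t ev0t /ev0t {}ev0t.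
by rewrite -[LHS]/(H1 (act1 ev T G t) h) H1_eq0// => s; rewrite /act1 TG0 ev0t.
Qed.

End NullKernels.

Theorem theorem4p8 (R : realType) (X : set (@aefun R setT))
    (opL opR : @op_family R) (m : nat) (B : 'I_m -> @aefun R setT -> R)
    (ev : @aefun R setT -> R -> R) (h : @aefun R setT) (G : R -> R -> R)
    (imL := fun U : set R => opL U @` restr_space X U)
    (imR := fun U : set R => opR U @` imL U)
    (L := opL setT) (R' := opR setT)
    (RL := fun f => R' (L f)) (BR := fun i f => B i (R' f))
    (hX : X `<=` L1loc setT)
    (hXlin : submod_closed [in X])
    (hP : property_P X)
    (hLloc : locality (restr_space X) opL)
    (hRloc : locality imL opR)
    (hLres : restriction (restr_space X) opL)
    (hRres : restriction imL opR)
    (hXL : forall U, open U -> restr_space X U `<=` imL U)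
    (hLR : forall U, open U -> imL U `<=` imR U)
    (hB : forall i, linear_on (imR setT) (B i : _ -> R^o))
    (hev : forall f, cls setT (ev f) = f)
    (hh : imL setT h)
    (hcomm : forall f, X f -> X (R' f) -> L (R' f) = R' (L f))
    (hG : spaceZ X G)
    (* (I) *)
    (hI_def : forall s, X (cls setT (G^~ s)))
    (hI : forall s, RL (cls setT (G^~ s)) = 0)
    (* (II) *)
    (hII : forall i s, act1_functional (B i) G s = 0)
    (* (III) *)
    (hIII : forall i s, act1_functional (BR i) G s = 0)
    (* (IV) *)
    (hIV_def : [/\ H_defined G (ev h), X (cls setT (H G (ev h))) &
                   H_defined (act1 ev RL G) (ev h)])
    (hIV : RL (cls setT (H G (ev h)))
           = cls setT (H (act1 ev RL G) (ev h)) + h)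
    (* (V) *)
    (hV_def : [/\ H_defined (act1 ev R' G) (ev h),
                  X (cls setT (H (act1 ev R' G) (ev h))),
                  (forall s, X (cls setT ((act1 ev R' G)^~ s))) &
                  H_defined (act1 ev L (act1 ev R' G)) (ev h)])
    (hV : L (cls setT (H (act1 ev R' G) (ev h)))
          = cls setT (H (act1 ev L (act1 ev R' G)) (ev h)) + h)
    (* (VI) *)
    (hVI_def : forall i, H1_defined (act1_functional (B i) G) (ev h))
    (hVI : forall i, B i (cls setT (H G (ev h)))
                     = H1 (act1_functional (B i) G) (ev h))
    (* (VII) *)
    (hVII_def : forall i, H1_defined (act1_functional (BR i) G) (ev h))
    (hVII : forall i,
       B i (R' (cls setT (H G (ev h))))
         = B i (cls setT (H (act1 ev R' G) (ev h))) /\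
       B i (cls setT (H (act1 ev R' G) (ev h)))
         = H1 (act1_functional (BR i) G) (ev h)) :
  let v := cls setT (H G (ev h)) in
  let u := cls setT (H (act1 ev R' G) (ev h)) in
  [/\ X v, R' (L v) = h & forall i, B i v = 0 /\ B i (R' v) = 0] /\
  [/\ X u, L u = h & forall i, B i u = 0].
Proof.
move=> v u.
have [_ Xv _] := hIV_def; have [_ Xu XRG _] := hV_def.
have Bu i : B i u = 0.
  by have [_ ->] := hVII i; apply: H1_eq0; exact: hIII.
split; split => //.
- by rewrite -[R' (L v)]/(RL v) hIV cls_H_act1_eq0// add0r.
- move=> i; split; first by rewrite hVI; apply: H1_eq0; exact: hII.
  by have [-> _] := hVII i; exact: Bu.
- rewrite hV act1_comp// cls_H_act1_eq0 ?add0r// => s /=.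
  rewrite hcomm; [exact: hI|exact: hI_def|].
  (* the column of [R_|- G] at [s] represents the class [R (G(., s))] *)
  by rewrite -[R' _]hev; exact: XRG.
Qed.
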